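(* Let $n\ge 1$ be an integer. If a spherical $n$-mosaic represents a knot (i.e. is a spherical knot $n$-mosaic), then it has at most $6n^2-3n+1$ crossings.
   Context: Mosaic tiles. The tile set is $\mathcal{T}=\{T_0,\dots,T_{10}\}$; each tile is a unit square with arcs joining midpoints of its sides (sides: left L, right R, top U, bottom D): $T_0$ is empty; $T_1,T_2,T_3,T_4$ contain one arc joining respectively L–D, R–D, R–U, L–U; $T_5$ contains the segment L–R; $T_6$ contains the segment U–D; $T_7$ contains two disjoint arcs L–D and R–U; $T_8$ contains two disjoint arcs R–D and L–U; $T_9$ is a crossing of L–R and U–D with L–R over; $T_{10}$ is a crossing of L–R and U–D with U–D over. The crossing tiles are $T_9$ and $T_{10}$; the crossings of a mosaic are its crossing tiles. The midpoint of a side of a tile is a connection point if it is an endpoint of an arc on that tile. Spherical mosaics. Let the boundary of the cube $[0,n]^3\subset\mathbb{R}^3$ (a topological $S^2$) have each of its six faces divided into an $n\times n$ grid of unit squares. A spherical $n$-mosaic is a placement of one tile of $\mathcal{T}$ (seen from outside the cube) on each of the $6n^2$ unit squares such that, for each side shared by two unit squares (including sides lying on edges of the cube), its midpoint is a connection point of one tile iff it is a connection point of the other. It is a spherical knot $n$-mosaic if its arcs form a single closed curve (going straight through crossings); it is then a knot diagram on $S^2$ and represents a knot. *)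

(* Defs.v *)
From HB Require Import structures.
From mathcomp Require Import all_boot all_order all_algebra.

Set Implicit Arguments.
Unset Strict Implicit.
Unset Printing Implicit Defensive.

Inductive side : predArgType := sL | sR | sU | sD.

Definition side_code (s : side) : 'I_4 :=
  match s with
  | sL => @Ordinal 4 0 isT | sR => @Ordinal 4 1 isT
  | sU => @Ordinal 4 2 isT | sD => @Ordinal 4 3 isT
  end.

Definition side_decode (i : 'I_4) : side := nth sL [:: sL; sR; sU; sD] i.

Lemma side_codeK : cancel side_code side_decode.
Proof. by case. Qed.

HB.instance Definition _ := Finite.copy side (can_type side_codeK).

Inductive tile : predArgType :=
  T0 | T1 | T2 | T3 | T4 | T5 | T6 | T7 | T8 | T9 | T10.

(* For the crossing tiles T9 and T10, the arc listed first is the one that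
   passes over. *)
Definition arcs (t : tile) : seq (side * side) :=
  match t with
  | T0 => [::]
  | T1 => [:: (sL, sD)]
  | T2 => [:: (sR, sD)]
  | T3 => [:: (sR, sU)]
  | T4 => [:: (sL, sU)]
  | T5 => [:: (sL, sR)]
  | T6 => [:: (sU, sD)]
  | T7 => [:: (sL, sD); (sR, sU)]
  | T8 => [:: (sR, sD); (sL, sU)]
  | T9 => [:: (sL, sR); (sU, sD)]
  | T10 => [:: (sU, sD); (sL, sR)]
  end.

Definition is_crossing (t : tile) : bool :=
  match t with T9 | T10 => true | _ => false end.

Definition connection_point (t : tile) (s : side) : bool :=
  has (fun a => (s == a.1) || (s == a.2)) (arcs t).

(* The unit square ((a, b), (i, j)) lies on the face of [0, n]^3 orthogonal to
   the coordinate axis a (axes are numbered mod 3), at coordinate n if b is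
   true and 0 if b is false.  It is in column i (from the left) and row j (from
   the bottom) of that face, in the frame given by [right_axis] and [up_axis]. *)
Definition face : Type := ('Z_3 * bool)%type.
Definition square (n : nat) : Type := (face * ('I_n * 'I_n))%type.

(* "Right" and "up" point in the positive direction of these axes.  They are
   ordered so that (right, up, outward normal) is positively oriented, that is,
   so that the face is seen from outside the cube. *)
Definition right_axis (f : face) : 'Z_3 :=
  (if f.2 then f.1 + 1 else f.1 + 2%:R)%R.
Definition up_axis (f : face) : 'Z_3 :=
  (if f.2 then f.1 + 2%:R else f.1 + 1)%R.

(* Twice the coordinates, relative to the lower left corner of a unit square,
   of the midpoint of a side. *)
Definition side_right (s : side) : nat :=
  match s with sL => 0 | sR => 2 | sU | sD => 1 end.
Definition side_up (s : side) : nat :=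
  match s with sD => 0 | sU => 2 | sL | sR => 1 end.

(* Twice the midpoint, in R^3, of the side s of the unit square q.  Since a side
   is determined by its midpoint, two squares share a side exactly when the
   corresponding midpoints agree, within a face or across an edge of the cube. *)
Definition midpoint (n : nat) (q : square n) (s : side) : {ffun 'Z_3 -> nat} :=
  [ffun k : 'Z_3 =>
    if k == right_axis q.1 then q.2.1.*2 + side_right s
    else if k == up_axis q.1 then q.2.2.*2 + side_up s
    else if q.1.2 then n.*2 else 0].

Definition mosaic (n : nat) : Type := square n -> tile.

Definition spherical_mosaic (n : nat) (M : mosaic n) : Prop :=
  forall (q q' : square n) (s s' : side), midpoint q s = midpoint q' s' ->
    connection_point (M q) s = connection_point (M q') s'.

(* (q, (s, t)) stands for an arc of the tile on q, traversed from s to t. *)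
Definition strand (n : nat) : Type := (square n * (side * side))%type.

Definition reverse (n : nat) (x : strand n) : strand n :=
  (x.1, (x.2.2, x.2.1)).

Definition is_arc (n : nat) (M : mosaic n) (x : strand n) : bool :=
  x.2 \in arcs (M x.1).

Definition followed_by (n : nat) : rel (strand n) :=
  fun x y => midpoint x.1 x.2.2 == midpoint y.1 y.2.1.

(* The arcs can be arranged in a nonempty cyclic sequence, each arc being
   traversed exactly once (in one of its two directions) and ending where the
   next one starts.  Crossings are passed straight through because their arcs
   are L-R and U-D. *)
Definition single_closed_curve (n : nat) (M : mosaic n) : Prop :=
  exists c : seq (strand n),
    [/\ c <> [::],
        cycle (@followed_by n) c,
        forall x, x \in c -> is_arc M x || is_arc M (reverse x)
      & forall x, is_arc M x -> count_mem x c + count_mem (reverse x) c = 1].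

Definition spherical_knot_mosaic (n : nat) (M : mosaic n) : Prop :=
  spherical_mosaic M /\ single_closed_curve M.

Definition crossings (n : nat) (M : mosaic n) : {set square n} :=
  [set q | is_crossing (M q)].

(* Main.v *)
Require Import Defs.
From mathcomp Require Import all_boot all_order all_algebra.
From mathcomp Require Import zify.

(** The squares of the cube surface are arranged in [3 * n] closed bands: for
    each axis and each of the [n] layers orthogonal to it, the [4 * n] squares
    that surround the cube in that layer.  Every square lies on exactly two
    bands, one for its left and right sides and one for its upper and lower
    sides.  The curve stays on its band when it passes from a square to
    the next, because the band can be read off from the midpoint of the common
    side ([band_midpoint]), and crossings are passed straight through, so it can
    change bands only inside a tile that is not a crossing.

    Consider the graph whose vertices are the bands and whose edges are the
    squares without a crossing, each joining its two bands.  It is connected: a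
    property of bands that is constant along every edge is constant along the
    curve; as the curve runs along both bands of every crossing, the property
    agrees on any two bands that meet, whether at a crossing or not
    ([separation_crossing]), and bands around different axes always meet
    ([separation_const]).

    A connected graph on [3 * n] vertices has at least [3 * n - 1] edges
    ([connected_card]), which leaves at most [6 * n ^ 2 - (3 * n - 1)] squares
    for crossings. *)

Set Implicit Arguments.
Unset Strict Implicit.
Unset Printing Implicit Defensive.

(** Connectedness is expressed by the absence of a nontrivial separation, which
    is the form in which the closed curve provides it.  The bound comes from
    growing a set of vertices one at a time: as long as the set is proper, some
    edge leaves it, and adding the far end of that edge adds one vertex and at
    least one inner edge. *)
Lemma connected_card (V E : finType) (D : {set E}) (f g : E -> V) :
    (forall P : pred V, {in D, forall e, P (f e) = P (g e)} ->
      forall u v, P u = P v) ->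
  #|V| <= #|D|.+1.
Proof.
move=> conn; case: (posnP #|V|) => [-> //|V_gt0].
have /card_gt0P[v0 _] := V_gt0.
pose inner (S : {set V}) := [set e in D | (f e \in S) && (g e \in S)].
have grow k : k < #|V| -> exists2 S : {set V}, #|S| = k.+1 & k <= #|inner S|.
  elim: k => [_|k IHk ltkV]; first by exists [set v0]; rewrite ?cards1.
  have [S cardS leS] := IHk (ltnW ltkV).
  have [u uS] : exists u, u \in S by apply/card_gt0P; rewrite cardS.
  have [v vS] : exists v, v \notin S.
    have /card_gt0P[v] : 0 < #|~: S| by have := cardsC S; rewrite cardS; lia.
    by rewrite inE => vS; exists v.
  have [e eD neq_e] : exists2 e, e \in D & (f e \in S) != (g e \in S).
    apply/exists_inP; apply: contraT; rewrite negb_exists_in => /forall_inP eqS.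
    suff: (u \in S) = (v \in S) by rewrite uS (negPf vS).
    by apply: (conn (mem S)) => e /eqS; rewrite negbK => /eqP.
  pose w := if f e \in S then g e else f e.
  have wS : w \notin S.
    by move: neq_e; rewrite /w; case: ifP => [_|->]; case: (g e \in S).
  exists (w |: S); first by rewrite cardsU1 wS cardS.
  apply: leq_ltn_trans leS _; apply: proper_card; apply/properP; split.
    by apply/subsetP=> d; rewrite !inE => /and3P[-> -> ->]; rewrite !orbT.
  exists e; rewrite !inE eD; move: neq_e; rewrite /w.
    by case: (boolP (f e \in S)); case: (boolP (g e \in S)); rewrite eqxx ?orbT.
  by case: (f e \in S); case: (g e \in S).
have [S _ leS] : exists2 S : {set V}, #|S| = #|V|.-1.+1 & #|V|.-1 <= #|inner S|.
  by apply: grow; rewrite prednK.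
have : inner S \subset D by apply/subsetP=> e; rewrite inE => /andP[].
by move/subset_leq_card; lia.
Qed.

(** Names the band by the axis it surrounds and its layer along this axis, so
    that the left and right sides of a square are on the same band, as are its
    upper and lower sides. *)
Definition band (n : nat) (q : square n) (s : side) : 'Z_3 * 'I_n :=
  match s with
  | sL | sR => (up_axis q.1, q.2.2)
  | sU | sD => (right_axis q.1, q.2.1)
  end.

(** The midpoint of a side has exactly one odd coordinate, in the direction of
    the side, and this direction is the axis that the band surrounds. *)
Lemma odd_midpoint (n : nat) (q : square n) (s : side) (k : 'Z_3) :
  odd (midpoint q s k) = (k == (band q s).1).
Proof.
case: q => [[a b] [i j]]; rewrite ffunE /right_axis /up_axis /=.
case: a => [[|[|[|//]]] ?]; case: k => [[|[|[|//]]] ?]; case: b; case: s;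
  by rewrite -!val_eqE /= ?oddD ?odd_double.
Qed.

Lemma half_midpoint (n : nat) (q : square n) (s : side) :
  (midpoint q s (band q s).1)./2 = (band q s).2.
Proof.
case: q => [[a b] [i j]]; rewrite ffunE /right_axis /up_axis /=.
case: a => [[|[|[|//]]] ?]; case: b; case: s;
  by rewrite -!val_eqE /= addn1; apply: uphalf_double.
Qed.

Lemma band_midpoint (n : nat) (q q' : square n) (s s' : side) :
  midpoint q s = midpoint q' s' -> band q s = band q' s'.
Proof.
move=> eq_m; have eq1 : (band q s).1 = (band q' s').1.
  by apply/eqP; rewrite -odd_midpoint -eq_m odd_midpoint.
have eq2 : (band q s).2 = (band q' s').2.
  by apply: val_inj; rewrite /= -!half_midpoint eq_m eq1.
by rewrite (surjective_pairing (band q s)) eq1 eq2 -surjective_pairing.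
Qed.

Definition separation (n : nat) (M : mosaic n) (P : pred ('Z_3 * 'I_n)) :=
  {in ~: crossings M, forall q, P (band q sL) = P (band q sU)}.

Lemma separation_arc (n : nat) (M : mosaic n) (P : pred ('Z_3 * 'I_n))
    (x : strand n) :
  separation M P -> is_arc M x -> P (band x.1 x.2.1) = P (band x.1 x.2.2).
Proof.
case: x => q [s t] sepP; rewrite /is_arc /=; have := sepP q; rewrite !inE.
case: (M q) => //= sepq; case: s; case: t => //= _;
  first [exact: sepq | exact/esym/sepq].
Qed.

(** Along the closed curve [P] does not change, neither within an arc nor from
    an arc to the next, and the curve uses both arcs of a crossing. *)
Lemma separation_crossing (n : nat) (M : mosaic n) (P : pred ('Z_3 * 'I_n))
    (q : square n) :
  single_closed_curve M -> separation M P -> P (band q sL) = P (band q sU).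
Proof.
case=> c [_ cyc_c arc_c count_c] sepP.
have [crq|ncrq] := boolP (q \in crossings M); last by apply: sepP; rewrite inE.
have ends x : x \in c -> P (band x.1 x.2.1) = P (band x.1 x.2.2).
  by move=> /arc_c /orP[] /(separation_arc sepP).
have const_c x y : x \in c -> y \in c ->
    P (band x.1 x.2.1) = P (band y.1 y.2.1).
  pose R : rel (strand n) :=
    fun z1 z2 => P (band z1.1 z1.2.1) == P (band z2.1 z2.2.1).
  have trR : transitive R.
    by move=> z z1 z2 /eqP eq1 /eqP eq2; rewrite /R eq1 eq2.
  suff: cycle R c.
    by rewrite (cycle_all2rel trR) => /allrelP R_c xc yc; apply/eqP/R_c.
  apply: (sub_in_cycle _ (allss c) cyc_c) => z1 z2 z1c _ /eqP/band_midpoint eqb.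
  by rewrite /R ends // eqb.
have visited s t : (s, t) \in arcs (M q) ->
    exists2 x, x \in c & P (band x.1 x.2.1) = P (band q s).
  move=> arc_st; have := count_c (q, (s, t)) arc_st.
  have [xc _|] := boolP ((q, (s, t)) \in c); first by exists (q, (s, t)).
  move/count_memPn->; rewrite add0n => count1.
  have xc : reverse (q, (s, t)) \in c by rewrite -has_pred1 has_count count1.
  by exists (reverse (q, (s, t))) => //=; rewrite (ends _ xc).
have [|x xc <-] := visited sL sR; first by move: crq; rewrite inE; case: (M q).
have [|y yc <-] := visited sU sD; first by move: crq; rewrite inE; case: (M q).
exact: const_c.
Qed.

(** Any band around the axis [k] meets any band around the next axis on a face
    orthogonal to the third one; going once around the three axes also links two
    bands around the same axis. *)
Lemma separation_const (n : nat) (M : mosaic n) (P : pred ('Z_3 * 'I_n)) :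
  single_closed_curve M -> separation M P -> forall u v, P u = P v.
Proof.
move=> curve sepP.
have meet (k : 'Z_3) (i j : 'I_n) : P ((k + 1)%R, i) = P (k, j).
  have := separation_crossing ((k - 1, true), (j, i))%R curve sepP.
  have -> : band ((k - 1, true), (j, i))%R sL = ((k + 1)%R, i).
    congr (_, _); rewrite /up_axis /=; apply/val_inj.
    by case: k => [[|[|[|//]]] ?].
  have -> // : band ((k - 1, true), (j, i))%R sU = (k, j).
  by rewrite /band /right_axis /= GRing.subrK.
have eq0 k i j : P (k, i) = P (0%R, j).
  have [->|->|->] : [\/ k = 0%R, k = (0 + 1)%R | k = (0 + 1 + 1)%R].
  - by case: k => [[|[|[|//]]] ?];
      [apply: Or31 | apply: Or32 | apply: Or33]; apply/val_inj.
  - by rewrite -(meet _ i) (meet _ _ j).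
  - exact: meet.
  - by rewrite (meet _ _ i).
by case=> [k i] [l j]; rewrite (eq0 k i j) (eq0 l j j).
Qed.

Theorem theorem1p3 (n : nat) (hn : 1 <= n) (M : mosaic n)
    (hM : spherical_knot_mosaic M) :
  #|crossings M| <= 6 * n ^ 2 - 3 * n + 1.
Proof.
have [_ curve] := hM.
have : #|{: 'Z_3 * 'I_n}| <= #|~: crossings M|.+1.
  apply: (connected_card (f := fun q => band q sL) (g := fun q => band q sU)).
  by move=> P; apply: separation_const.
have card_Z3 : #|'Z_3| = 3 by rewrite card_ord.
have := cardsC (crossings M).
by rewrite !card_prod card_bool card_Z3 !card_ord -mulnn; lia.
Qed.
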